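(* Let $0<p<1$ and let $\varphi(z)=|\operatorname{Im} z|+|z|^p$ for $z\in\mathbb{C}$. Then every holomorphic polynomial belongs to $H^2(\mathbb{C},e^{-\varphi})$, but the holomorphic polynomials are not dense in $H^2(\mathbb{C},e^{-\varphi})$.
   Context: $H^2(\mathbb{C},e^{-\varphi})$ is the space of entire functions $f$ with $\|f\|^2:=\int_{\mathbb{C}}|f|^2e^{-\varphi}\,d\lambda<\infty$, where $\lambda$ is Lebesgue measure; density is with respect to this norm. *)

(* Defs.v *)
From HB Require Import structures.
From mathcomp Require Import all_boot all_order all_algebra.
From mathcomp Require Import complex.
From mathcomp Require Import all_classical all_reals all_analysis.

Set Implicit Arguments.
Unset Strict Implicit.
Unset Printing Implicit Defensive.

Import Order.TTheory GRing.Theory Num.Theory.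
Import numFieldNormedType.Exports.
Local Open Scope classical_set_scope.
Local Open Scope ring_scope.

(* The modulus as an element of R: the norm of the library on R[i] takes its
   values in R[i] itself. *)
Definition cmod (R : realType) (z : R[i]) : R := ComplexField.Normc.normc z.

(* Derivability in direction 1, the scalar field being R[i]: this is the
   existence of the limit of (f (z + h) - f z) / h as h tends to 0 in R[i]. *)
Definition entire (R : realType) (f : R[i] -> R[i]) : Prop :=
  forall z : R[i], derivable (f : R[i]^o -> R[i]^o) z 1.

(* Integral over C of a nonnegative function, for planar Lebesgue measure in
   the coordinates (x, y) |-> x + iy. *)
Definition cintegral (R : realType) (g : R[i] -> R) : \bar R :=
  (\int[lebesgue_measure \x lebesgue_measure]_(w in [set: R * R])
     (g (Complex w.1 w.2))%:E)%E.

Definition H2_sqnorm (R : realType) (phi : R[i] -> R) (f : R[i] -> R[i]) :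
    \bar R :=
  cintegral (fun z => cmod (f z) ^+ 2 * expR (- phi z)).

Definition H2_norm (R : realType) (phi : R[i] -> R) (f : R[i] -> R[i]) :
    \bar R :=
  sqrte (H2_sqnorm phi f).

Definition H2 (R : realType) (phi : R[i] -> R) : set (R[i] -> R[i]) :=
  [set f | entire f /\ (H2_sqnorm phi f < +oo)%E].

Definition H2_dense (R : realType) (phi : R[i] -> R)
    (A : set (R[i] -> R[i])) : Prop :=
  forall f : R[i] -> R[i], H2 phi f -> forall e : R, 0 < e ->
    exists2 g, A g & (H2_norm phi (fun z => f z - g z)%R < e%:E)%E.

Definition polynomials (R : realType) : set (R[i] -> R[i]) :=
  range (fun (q : {poly R[i]}) (z : R[i]) => q.[z]).

Definition weight (R : realType) (p : R) (z : R[i]) : R :=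
  `|complex.Im z| + cmod z `^ p.

(* Main.v *)
(** Put f(z) = exp(-iz/2); then |f|^2 exp(-phi) <= exp(-|z|^p), so f lies in the
    space. For G'' = g let D G(z) = G(z+1+i) - G(z+1) - G(z+i) + G(z); this is i
    times the integral of g over the unit square at z, so |D G(z)| is at most
    the L^2 norm of g there. If a polynomial q is close to f, apply this to
    g = f - q: with P'' = q, the polynomial Q = D P is close to kappa f,
    pointwise up to the weight, where kappa <> 0. In particular
    |Q(x)| <= B exp((|x|+2)^p/2) on the real line, with B independent of q.

    Since p < 1, polynomials with such a bound have exponential type zero,
    uniformly: the product E of (1 - iz/2^j)^(2 n_j), with n_j about 2^(p(j+2)),
    has no zeros in the upper half plane and dominates exp((|x|+2)^p/2) on the
    real line, so the maximum principle for Q/E gives |Q(iy)| <= B'|E(iy)|. As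
    the sum of n_j/2^j converges, E(iy) = o(exp(y/2)), whereas
    |kappa f(iy)| = |kappa| exp(y/2). *)
Require Import Defs.
From HB Require Import structures.
From mathcomp Require Import all_boot all_order all_algebra.
From mathcomp Require Import complex.
From mathcomp Require Import all_classical all_reals all_analysis.
From mathcomp Require Import measurable_realfun.
From mathcomp Require Import ring lra.
Import Order.TTheory GRing.Theory Num.Theory.
Import numFieldNormedType.Exports.
Local Open Scope classical_set_scope.
Local Open Scope ring_scope.

Local Notation Re := complex.Re.
Local Notation Im := complex.Im.

(** * The modulus *)

Section Modulus.
Context {R : realType}.
Implicit Types z w : R[i].

Lemma cmodE z : cmod z = Num.sqrt (Re z ^+ 2 + Im z ^+ 2).
Proof. by case: z. Qed.

Lemma cmod_ge0 z : 0 <= cmod z.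
Proof. by rewrite cmodE sqrtr_ge0. Qed.

Lemma sqr_cmod z : cmod z ^+ 2 = Re z ^+ 2 + Im z ^+ 2.
Proof. by rewrite cmodE sqr_sqrtr // addr_ge0 ?sqr_ge0. Qed.

Lemma normr_cmod z : `|z| = (cmod z)%:C%C.
Proof. by case: z. Qed.

Lemma cmodM z w : cmod (z * w) = cmod z * cmod w.
Proof. exact: ComplexField.Normc.normcM. Qed.

Lemma cmodX z n : cmod (z ^+ n) = cmod z ^+ n.
Proof.
elim: n => [|n IH]; first by rewrite !expr0; exact: ComplexField.Normc.normc1.
by rewrite !exprS cmodM IH.
Qed.

Lemma cmodD z w : cmod (z + w) <= cmod z + cmod w.
Proof. exact: le_normcD. Qed.

Lemma cmodN z : cmod (- z) = cmod z.
Proof. by rewrite !cmodE; case: z => x y /=; rewrite !sqrrN. Qed.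

Lemma cmod_eq0 z : (cmod z == 0) = (z == 0).
Proof.
apply/eqP/eqP => [/ComplexField.Normc.eq0_normc //|->].
exact: ComplexField.Normc.normc0.
Qed.

Lemma cmod_gt0 z : (0 < cmod z) = (z != 0).
Proof. by rewrite lt_neqAle cmod_ge0 andbT eq_sym cmod_eq0. Qed.

Lemma cReD z w : Re (z + w) = Re z + Re w. Proof. by case: z; case: w. Qed.
Lemma cImD z w : Im (z + w) = Im z + Im w. Proof. by case: z; case: w. Qed.
Lemma cReN z : Re (- z) = - Re z. Proof. by case: z. Qed.
Lemma cImN z : Im (- z) = - Im z. Proof. by case: z. Qed.
Lemma cReM z w : Re (z * w) = Re z * Re w - Im z * Im w.
Proof. by case: z; case: w. Qed.
Lemma cImM z w : Im (z * w) = Re z * Im w + Im z * Re w.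
Proof. by case: z => a b; case: w => c d. Qed.

Lemma Re_le_cmod z : `|Re z| <= cmod z.
Proof.
rewrite -(ler_pXn2r (n:=2)) ?nnegrE ?cmod_ge0 ?normr_ge0 //.
by rewrite sqr_cmod real_normK ?num_real // lerDl sqr_ge0.
Qed.

Lemma Im_le_cmod z : `|Im z| <= cmod z.
Proof.
rewrite -(ler_pXn2r (n:=2)) ?nnegrE ?cmod_ge0 ?normr_ge0 //.
by rewrite sqr_cmod real_normK ?num_real // lerDr sqr_ge0.
Qed.

Lemma cmod_le_ReIm z : cmod z <= `|Re z| + `|Im z|.
Proof.
rewrite -(ler_pXn2r (n:=2)) ?nnegrE ?cmod_ge0 ?addr_ge0 //.
rewrite sqr_cmod sqrrD !real_normK ?num_real //.
have := mulr_ge0 (normr_ge0 (Re z)) (normr_ge0 (Im z)).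
by nra.
Qed.

(* With [P] "continuous" or "measurable" this transfers regularity to
   polynomials of a complex-valued function. *)
Lemma horner_ReIm {T : Type} (P : (T -> R) -> Prop) :
  (forall c : R, P (fun=> c)) ->
  (forall u v, P u -> P v -> P (fun t => u t + v t)) ->
  (forall u v, P u -> P v -> P (fun t => u t * v t)) ->
  forall (q : {poly R[i]}) (f : T -> R[i]),
    P (fun t => Re (f t)) -> P (fun t => Im (f t)) ->
    P (fun t => Re q.[f t]) /\ P (fun t => Im q.[f t]).
Proof.
move=> Pc PD PM q f Pr Pi.
elim/poly_ind: q => [|q c [IHr IHi]].
  by under eq_fun do rewrite horner0; under [X in _ /\ P X]eq_fun do rewrite horner0;
     split; apply: Pc.
have PN u : P u -> P (fun t => - u t).
  move=> Pu; have := PM _ _ (Pc (-1)) Pu.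
  by under eq_fun do rewrite mulN1r.
have e t : (q * 'X + c%:P).[f t] = q.[f t] * f t + c by rewrite !hornerE.
split.
  under eq_fun do rewrite e cReD cReM.
  by apply: (PD) => //; apply: (PD); [exact: PM|exact: (PN _ (PM _ _ _ _))].
under eq_fun do rewrite e cImD cImM.
by apply: (PD) => //; apply: (PD); exact: PM.
Qed.

Lemma horner_continuous_ReIm {T : topologicalType} (q : {poly R[i]})
    (f : T -> R[i]) :
  continuous (fun t => Re (f t)) -> continuous (fun t => Im (f t)) ->
  continuous (fun t => Re q.[f t]) /\ continuous (fun t => Im q.[f t]).
Proof.
apply: (@horner_ReIm T (fun u => continuous u)).
- by move=> c t; exact: cvg_cst.
- by move=> u v cu cv t; apply: cvgD; [exact: cu|exact: cv].
- by move=> u v cu cv t; apply: cvgM; [exact: cu|exact: cv].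
Qed.

End Modulus.

(** * The maximum principle in the upper half plane *)

Section MaximumPrinciple.
Context {R : realType}.
Implicit Types z w : R[i].

Lemma nth_root_exists (k : nat) (c : R[i]) : (0 < k)%N ->
  exists w, w ^+ k = c.
Proof.
move=> k0; have /closed_rootP[w] : size ('X^k - c%:P) != 1%N.
  by rewrite size_XnsubC //; case: k k0.
by rewrite rootE !hornerE subr_eq0 => /eqP; exists w.
Qed.

(* Near a zero [z0] of [q - l E], one can move in a direction where
   [q - l E] is positively proportional to [l E], so that [q] outgrows [l E]. *)
Lemma no_local_max (q E : {poly R[i]}) (l z0 : R[i]) :
  q != l *: E -> q.[z0] = l * E.[z0] -> l * E.[z0] != 0 ->
  exists w : R[i], forall eps : R, 0 < eps -> exists2 t : R, 0 < t < eps &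
    cmod l * cmod E.[z0 + t%:C%C * w] < cmod q.[z0 + t%:C%C * w].
Proof.
move=> qE qz0 lE0.
have g0 : q - l *: E != 0 by rewrite subr_eq0.
have [k [r rz0 gE]] := multiplicity_XsubC (q - l *: E) z0.
rewrite g0 /= in rz0.
have k0 : (0 < k)%N.
  case: k gE => // gE; move: rz0; rewrite rootE.
  by rewrite expr0 mulr1 in gE; rewrite -gE !hornerE qz0 subrr eqxx.
have rn0 : r.[z0] != 0 by rewrite -rootE.
have [w wk] := nth_root_exists _ (l * E.[z0] / r.[z0]) k0.
exists w => eps eps0.
pose z (t : R) := z0 + t%:C%C * w.
pose a t := l * E.[z t]; pose b t := w ^+ k * r.[z t].
have qz t : q.[z t] = a t + (t ^+ k)%:C%C * b t.
  have := congr1 (fun p => p.[z t]) gE.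
  rewrite !(hornerE, horner_exp) => /eqP; rewrite subr_eq => /eqP ->.
  rewrite addrC; congr (_ + _).
  have -> : z t - z0 = t%:C%C * w by rewrite /z addrC addKr.
  by rewrite exprMn rmorphXn /b; exact: mulrC.
have cz : continuous (fun t => Re (z t)) /\ continuous (fun t => Im (z t)).
  split => t.
    under eq_fun do rewrite cReD cReM /= mul0r subr0.
    by apply: cvgD; [exact: cvg_cst|apply: cvgM; [exact: cvg_id|exact: cvg_cst]].
  under eq_fun do rewrite cImD cImM /= mul0r addr0.
  by apply: cvgD; [exact: cvg_cst|apply: cvgM; [exact: cvg_id|exact: cvg_cst]].
have [car cai] : continuous (fun t => Re (a t)) /\ continuous (fun t => Im (a t)).
  have := horner_continuous_ReIm (l *: E) _ cz.1 cz.2.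
  by under eq_fun do rewrite hornerZ;
     under [X in _ /\ continuous X]eq_fun do rewrite hornerZ.
have [cbr cbi] : continuous (fun t => Re (b t)) /\ continuous (fun t => Im (b t)).
  have := horner_continuous_ReIm (w ^+ k *: r) _ cz.1 cz.2.
  by under eq_fun do rewrite hornerZ;
     under [X in _ /\ continuous X]eq_fun do rewrite hornerZ.
(* [psi] is the real part of conj(a) b, and |a + t^k b|^2 = |a|^2 + 2 t^k psi + t^(2k) |b|^2. The
   choice of w^k makes b(0) = a(0), so psi(0) = |a(0)|^2 > 0. *)
pose psi t := Re (a t) * Re (b t) + Im (a t) * Im (b t).
have cpsi : psi t @[t --> 0] --> psi 0.
  by apply: cvgD; apply: cvgM; [exact: car|exact: cbr|exact: cai|exact: cbi].
have psi0 : 0 < psi 0.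
  have -> : psi 0 = cmod (a 0) ^+ 2.
    have ba : b 0 = a 0 by rewrite /a /b wk /z rmorph0 mul0r addr0 divfK.
    by rewrite /psi ba sqr_cmod -!expr2.
  by rewrite exprn_gt0 // cmod_gt0 /a /z rmorph0 mul0r addr0.
have pnear : \forall t \near 0^'+, 0 < psi t.
  exact: cvgr_gt (cvg_at_right_filter cpsi) _ psi0.
near (0:R)^'+ => t.
have t0 : 0 < t by near: t; exact: nbhs_right_gt.
have te : t < eps by near: t; exact: nbhs_right_lt.
have pt : 0 < psi t by near: t.
exists t; first by rewrite t0 te.
rewrite -cmodM -/(z t) -/(a t) qz -(ltr_pXn2r (n:=2)) ?nnegrE ?cmod_ge0 //.
move: pt; rewrite /psi; move: (a t) (b t) => u v pt.
rewrite !sqr_cmod cReD cImD cReM cImM /= !mul0r subr0 addr0.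
rewrite [ltRHS](_ : _ = (Re u ^+ 2 + Im u ^+ 2) +
  2 * t ^+ k * (Re u * Re v + Im u * Im v) +
  (t ^+ k) ^+ 2 * (Re v ^+ 2 + Im v ^+ 2)); last by ring.
rewrite -addrA ltrDl; apply: ltr_pwDl.
  by rewrite !mulr_gt0 ?exprn_gt0.
by rewrite mulr_ge0 ?addr_ge0 ?sqr_ge0.
Unshelve. all: by end_near. Qed.

(** If the bound failed, |q/E|^2 would have a maximum above B^2 on a compact rectangle. Both the
    real line and the region |z| >= X obey the bound, so the maximum point has Im z > 0 and |z| < X,
    where [no_local_max] reaches a larger value. *)
Lemma half_plane_max_principle (q E : {poly R[i]}) (B X : R) :
  0 < X -> 0 <= B ->
  (forall z, 0 <= Im z -> E.[z] != 0) ->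
  (forall z, Im z = 0 -> cmod q.[z] <= B * cmod E.[z]) ->
  (forall z, 0 <= Im z -> X <= cmod z -> cmod q.[z] <= B * cmod E.[z]) ->
  forall z, 0 <= Im z -> cmod q.[z] <= B * cmod E.[z].
Proof.
move=> X0 B0 En0 qreal qfar z1 z1ge0; rewrite leNgt; apply/negP => z1B.
have z1X : cmod z1 < X.
  by rewrite ltNge; apply/negP => /(qfar _ z1ge0); rewrite leNgt z1B.
pose D : set (R * R) := `[-X, X] `*` `[0, X].
pose pt (w : R * R) := Complex w.1 w.2.
pose N (p : {poly R[i]}) (w : R * R) := Re p.[pt w] ^+ 2 + Im p.[pt w] ^+ 2.
have NE p (w : R * R) : N p w = cmod p.[pt w] ^+ 2 by rewrite sqr_cmod.
have cN p : continuous (N p).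
  have [cr ci] := @horner_continuous_ReIm R (R * R)%type p pt
    (fun t => cvg_fst) (fun t => cvg_snd).
  by move=> t; rewrite /N; under eq_fun do rewrite !expr2;
     apply: cvgD; apply: cvgM; (apply: cr || apply: ci).
have EN (w : R * R) : D w -> 0 < N E w.
  move=> [_]; rewrite /= in_itv /= => /andP[w2 _].
  by rewrite NE exprn_gt0 // cmod_gt0 En0.
have [||| w0 w0D w0max] := @compact_EVT_max _ R (fun w : R * R => N q w / N E w) D.
- by exists (0, 0); split; rewrite /= in_itv /= ?lexx ?oppr_le0 ltW.
- by apply: compact_setX; exact: segment_compact.
- apply: continuous_in_subspaceT => w /set_mem wD.
  apply: cvgM; first exact: cN.
  by apply: cvgV; [rewrite gt_eqF // EN|exact: cN].
have inD z : 0 <= Im z -> cmod z < X -> (Re z, Im z) \in D.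
  move=> iz0 zX; rewrite inE; split; rewrite /= in_itv /=.
    by rewrite -ler_norml (le_trans (Re_le_cmod z)) // ltW.
  by rewrite iz0 (le_trans (ler_norm _)) // (le_trans (Im_le_cmod z)) // ltW.
have ptE z : pt (Re z, Im z) = z by case: z.
have w0B : B ^+ 2 < N q w0 / N E w0.
  apply: lt_le_trans (w0max _ (inD _ z1ge0 z1X)).
  rewrite ltr_pdivlMr; last by apply: EN; have := inD _ z1ge0 z1X; rewrite inE.
  rewrite !NE ptE -exprMn ltr_pXn2r ?nnegrE ?cmod_ge0 ?mulr_ge0 ?cmod_ge0 //.
move: w0D; rewrite inE => w0D; have EN0 := EN _ w0D.
set z0 := pt w0.
have z0B : B * cmod E.[z0] < cmod q.[z0].
  move: w0B; rewrite ltr_pdivlMr // !NE -exprMn ltr_pXn2r //;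
  by rewrite nnegrE ?cmod_ge0 ?mulr_ge0 ?cmod_ge0.
have z0ge0 : 0 <= Im z0 by case: w0D => _; rewrite /= in_itv /= => /andP[].
have E0 := En0 _ z0ge0.
have z0gt0 : 0 < Im z0.
  rewrite lt_neqAle z0ge0 andbT eq_sym; apply/eqP => /qreal.
  by rewrite leNgt z0B.
have z0X : cmod z0 < X.
  by rewrite ltNge; apply/negP => /(qfar _ z0ge0); rewrite leNgt z0B.
pose l := q.[z0] / E.[z0].
have qz0 : q.[z0] = l * E.[z0] by rewrite divfK.
have lB : B < cmod l.
  by move: z0B; rewrite qz0 cmodM ltr_pM2r // cmod_gt0.
(* If q = l E, the bound on the real line, tested at the point X, would give |l| <= B. *)
have qlE : q != l *: E.
  apply/eqP => qE; have /= := qreal X%:C%C erefl.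
  rewrite qE hornerZ cmodM ler_pM2r ?cmod_gt0 ?En0 //.
  by rewrite leNgt lB.
have l0 : l != 0 by rewrite -cmod_gt0 (le_lt_trans B0).
have [w wP] := no_local_max _ _ _ _ qlE qz0 (mulf_neq0 l0 E0).
(* A displacement shorter than this minimum stays in the upper half plane and in the disc of radius
   X, hence in the rectangle. *)
have m0 : 0 < Num.min (Im z0) (X - cmod z0) by rewrite lt_min z0gt0 subr_gt0.
have w1 : 0 < cmod w + 1 by rewrite ltr_wpDl ?cmod_ge0.
have [t /andP[t0 te]] := wP _ (divr_gt0 m0 w1).
set z := z0 + _; apply/negP; rewrite -leNgt.
have tw : t * cmod w < Num.min (Im z0) (X - cmod z0).
  rewrite ltr_pdivlMr // in te; apply: le_lt_trans te.
  by rewrite ler_pM2l // lerDl.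
have ctw : cmod (t%:C%C * w) = t * cmod w.
  by rewrite cmodM (cmodE t%:C%C) /= expr0n addr0 sqrtr_sqr gtr0_norm.
move: tw; rewrite lt_min -ctw => /andP[tw1 tw2].
have zge0 : 0 <= Im z.
  rewrite cImD -lerBlDr sub0r; apply: le_trans (ltW tw1).
  by rewrite (le_trans _ (Im_le_cmod _)) // -normrN ler_norm.
have zX : cmod z < X.
  by rewrite (le_lt_trans (cmodD _ _)) // -ltrBrDl.
have := w0max _ (inD _ zge0 zX).
rewrite ler_pdivrMr; last by apply: EN; have := inD _ zge0 zX; rewrite inE.
rewrite !NE ptE -/z0 qz0 cmodM exprMn mulfK ?expf_neq0 ?cmod_eq0 // -exprMn.
by rewrite ler_pXn2r // nnegrE ?mulr_ge0 ?cmod_ge0.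
Qed.

End MaximumPrinciple.

(** * Complex derivatives and the exponential *)

Section Derivative.

Lemma is_derive_cvg {K : numFieldType} (f : K^o -> K^o) (z l : K^o) :
  is_derive z 1 f l <-> h^-1 *: (f (h + z) - f z) @[h --> (0:K)^'] --> (l : K^o).
Proof.
have e : (fun h : K => h^-1 *: ((f \o shift z) (h *: 1) - f z)) =
    (fun h : K => h^-1 *: (f (h + z) - f z)).
  by apply/funext => h /=; rewrite [h *: 1]mulr1.
split => [[df <-]|df].
  by move: df; rewrite /derivable /derive e => /cvgP; apply.
apply: DeriveDef; first by rewrite /derivable e; apply: cvgP df.
by rewrite /derive e; apply/norm_cvg_lim.
Qed.

(** With the denominator cleared the estimate is trivial at h = 0, so a full neighbourhood replaces
    the punctured one. *)
Lemma is_deriveP {K : numFieldType} (f : K^o -> K^o) (z l : K^o) :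
  is_derive z 1 f l <->
  forall e : K, 0 < e ->
    \forall h \near (0 : K), `|f (h + z) - f z - h * l| <= e * `|h|.
Proof.
rewrite is_derive_cvg; split => [/cvgrPdist_le H e e0|H].
  have := H e e0; rewrite near_withinE; apply: filter_app; near=> h.
  have [->|h0] := eqVneq h 0; first by rewrite add0r !subrr mul0r subrr normr0 mulr0.
  move=> /(_ isT); rewrite distrC.
  rewrite -ler_pdivrMr ?normr_gt0 // -normfV -normrM.
  by rewrite mulrBl mulrAC divff // mul1r mulrC.
apply/cvgrPdist_le => e e0; have := H e e0.
rewrite near_withinE; apply: filter_app; near=> h => He h0.
rewrite distrC; move: He; rewrite -ler_pdivrMr ?normr_gt0 // -normfV -normrM.
by rewrite mulrBl mulrAC divff // mul1r mulrC.
Unshelve. all: by end_near. Qed.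

Lemma is_derive_horner {K : numFieldType} (p : {poly K}) (z : K^o) :
  is_derive z 1 (horner p : K^o -> K^o) p^`().[z].
Proof.
elim/poly_ind: p => [|p c IH].
  rewrite (_ : horner 0 = cst 0); last by apply/funext => x; rewrite horner0.
  by rewrite deriv0 horner0; exact: is_derive_cst.
rewrite (_ : horner _ =
    ((horner p : K^o -> K^o) * (id : K^o -> K^o)) + cst c); last first.
  by apply/funext => x; rewrite !hornerE.
apply: is_derive_eq.
rewrite derivD derivM derivX derivC addr0 mulr1 !hornerE [X in X + _]mulr1.
by rewrite addrC; congr (_ + _); exact: mulrC.
Qed.

Context {R : realType}.
Local Notation C := R[i].

(** A positive element of [R[i]] is real, so balls of complex radius are balls of real radius. *)
Lemma near0_complex (P : C -> Prop) :
  (\forall h \near (0 : C^o), P h) <->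
  exists2 d : R, 0 < d & forall h, cmod h < d -> P h.
Proof.
split.
  move=> /nbhs_ballP[[d d'] /= d0 H].
  move: d0; rewrite ltcE /= => /andP[/eqP d'0 d0].
  exists d => // h hd; apply: H; rewrite -ball_normE /ball_ /= sub0r normrN.
  by rewrite normr_cmod ltcE /= d'0 eqxx.
move=> [d d0 H]; apply/nbhs_ballP; exists (d%:C%C); first by rewrite /= ltcR.
move=> h; rewrite -ball_normE /ball_ /= sub0r normrN normr_cmod ltcR; exact: H.
Qed.

(* The scalar [c] is [1] or ['i] for the partial derivatives in [x] and [y]. *)
Lemma is_derive_line (G : C -> C) (z l c k : C) (s : R) :
  is_derive (z + s%:C%C * c : C^o) 1 (G : C^o -> C^o) l ->
  is_derive s 1 (fun t : R => Re (k * G (z + t%:C%C * c))) (Re (k * (c * l))).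
Proof.
move=> dG; apply/(@is_deriveP R) => e e0.
have M0 : 0 < cmod k * cmod c + 1 by rewrite ltr_wpDl ?mulr_ge0 ?cmod_ge0.
have := (is_deriveP _ _ _).1 dG (e / (cmod k * cmod c + 1))%:C%C.
rewrite ltcR divr_gt0 // => /(_ isT) /near0_complex[d d0 dP].
have c1 : 0 < cmod c + 1 by rewrite ltr_wpDl ?cmod_ge0.
apply/nbhs_ballP; exists (d / (cmod c + 1)); first exact: divr_gt0.
move=> h; rewrite -ball_normE /ball_ /= sub0r normrN => hd.
have {}hd : cmod (h%:C%C * c) < d.
  rewrite cmodM (cmodE h%:C%C) /= expr0n addr0 sqrtr_sqr.
  rewrite ltr_pdivlMr // in hd; apply: le_lt_trans hd.
  by rewrite ler_wpM2l // lerDl.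
have := dP _ hd.
rewrite !normr_cmod -rmorphM lecR cmodM (cmodE h%:C%C) /= expr0n addr0 sqrtr_sqr.
set D := _ - _ - _ => HD.
have -> : Re (k * G (z + (h + s)%:C%C * c)) - Re (k * G (z + s%:C%C * c)) -
    h * Re (k * (c * l)) = Re (k * D).
  rewrite /D (_ : h%:C%C * c + (z + s%:C%C * c) = z + (h + s)%:C%C * c); last first.
    by rewrite rmorphD; ring.
  move: (G _) (G _) => u v.
  by rewrite !(cReM, cReD, cImD, cImM, cReN, cImN) /=; ring.
rewrite (le_trans (Re_le_cmod _)) // cmodM.
apply: le_trans (ler_wpM2l (cmod_ge0 _) HD) _.
rewrite -mulrA mulrCA; apply: ler_wpM2l; first exact: ltW.
rewrite (_ : _ * _ = `|h| * (cmod k * cmod c / (cmod k * cmod c + 1))); last by ring.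
by rewrite ler_piMr // ler_pdivrMr // mul1r lerDl.
Qed.

(* [exp_half z] is [exp (- i z / 2)]. *)
Definition exp_half (z : C) : C :=
  Complex (expR (Im z / 2) * cos (Re z / 2)) (- (expR (Im z / 2) * sin (Re z / 2))).

Lemma exp_halfD z w : exp_half (z + w) = exp_half z * exp_half w.
Proof.
apply/eqP; rewrite eq_complex cReM cImM /= cReD cImD !mulrDl expRD sinD cosD.
by apply/andP; split; apply/eqP; ring.
Qed.

Lemma cmod_exp_half z : cmod (exp_half z) = expR (Im z / 2).
Proof.
rewrite cmodE /= sqrrN !exprMn -mulrDr cos2Dsin2 mulr1 sqrtr_sqr ger0_norm //.
Qed.

Lemma near0_first_order (f : R -> R) (l : R) : is_derive (0 : R) 1 f l ->
  forall e : R, 0 < e -> exists2 d : R, 0 < d &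
    forall h, `|h| < d -> `|f h - f 0 - h * l| <= e * `|h|.
Proof.
move=> /(@is_deriveP R) df e /df /nbhs_ballP[d /= d0 dP]; exists d => // h hd.
have := dP h; rewrite addr0; apply.
by rewrite -ball_normE /ball_ /= sub0r normrN.
Qed.

(** With a = Re h / 2 and b = Im h / 2, both coordinates of the error reduce to the real first-order
    expansions of exp, cos and sin at 0. *)
Lemma exp_half_first_order (e : R) : 0 < e -> exists2 d : R, 0 < d &
  forall h, cmod h < d ->
    cmod (exp_half h - 1 - h * Complex 0 (- 2^-1)) <= e * cmod h.
Proof.
move=> e0.
wlog e1 : e e0 / e <= 1.
  move=> H; have [|e1] := leP e 1; first exact: H.
  have [d d0 dP] := H 1 ltr01 (lexx _); exists d => // h /dP; move/le_trans; apply.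
  by rewrite ler_wpM2r ?cmod_ge0 // ltW.
have e8 : 0 < e / 8 by rewrite divr_gt0.
have [d1 d10 P1] := near0_first_order _ _ (is_derive_expR 0) _ e8.
have [d2 d20 P2] := near0_first_order _ _ (is_derive_cos 0) _ e8.
have [d3 d30 P3] := near0_first_order _ _ (is_derive_sin 0) _ e8.
(* The bound [e / 8] on |h| controls the product (e^b - 1) a, through |e^b - 1| <= 2 |b| <= |h|. *)
exists (Num.min (Num.min d1 d2) (Num.min d3 (e / 8))).
  by rewrite !lt_min d10 d20 d30 e8.
move=> h; rewrite !lt_min => /andP[/andP[h1 h2] /andP[h3 h4]].
pose a := Re h / 2; pose b := Im h / 2.
have ah : `|a| <= cmod h / 2.
  by rewrite /a normrM [`|2^-1|]ger0_norm // ler_wpM2r // Re_le_cmod.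
have bh : `|b| <= cmod h / 2.
  by rewrite /b normrM [`|2^-1|]ger0_norm // ler_wpM2r // Im_le_cmod.
have ch := cmod_ge0 h.
have := P1 b; have := P2 a; have := P3 a.
rewrite expR0 cos0 sin0 !subr0 !mulr1 oppr0 mulr0 !subr0.
move=> /(_ ltac:(lra)) Hs /(_ ltac:(lra)) Hc /(_ ltac:(lra)) He.
apply: le_trans (cmod_le_ReIm _) _.
rewrite !(cReD, cImD, cReM, cImM, cReN, cImN) /= -/a -/b.
rewrite (_ : expR b * cos a - 1 - _ =
    (expR b - 1 - b) + expR b * (cos a - 1)); last first.
  by rewrite /a /b; lra.
rewrite (_ : - (expR b * sin a) - 0 - _ =
    - (expR b * (sin a - a)) - (expR b - 1) * a); last first.
  by rewrite /a /b; lra.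
have a0 := normr_ge0 a; have b0 := normr_ge0 b.
have eb : `|expR b - 1| <= 2 * `|b|.
  rewrite -[_ - 1](subrK b) (le_trans (ler_normD _ _)) //.
  suff : e / 8 * `|b| <= `|b| by lra.
  by rewrite ler_piMl //; lra.
have eb2 : expR b <= 2.
  have := ler_norm (expR b - 1); lra.
have eb0 := expR_ge0 b.
have k1 : `|expR b * (cos a - 1)| <= 2 * (e / 8 * `|a|).
  by rewrite normrM ler_pM // ger0_norm.
have k2 : `|expR b * (sin a - a)| <= 2 * (e / 8 * `|a|).
  by rewrite normrM ler_pM // ger0_norm.
have k3 : `|(expR b - 1) * a| <= (e / 8) * `|a|.
  rewrite normrM ler_wpM2r //; lra.
have n1 := ler_normD (expR b - 1 - b) (expR b * (cos a - 1)).
have n2 := ler_normB (- (expR b * (sin a - a))) ((expR b - 1) * a).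
rewrite normrN in n2.
have k4 : e / 8 * `|a| <= e / 8 * (cmod h / 2) by rewrite ler_pM2l.
have k5 : e / 8 * `|b| <= e / 8 * (cmod h / 2) by rewrite ler_pM2l.
have k6 : 0 <= e * cmod h by rewrite mulr_ge0 // ltW.
lra.
Qed.

Lemma is_derive_exp_half (z : C^o) :
  is_derive z 1 (exp_half : C^o -> C^o) (Complex 0 (- 2^-1) * exp_half z).
Proof.
apply/(@is_deriveP C) => -[e e'] /[dup] e0; rewrite ltcE /= => /andP[/eqP -> {e' e0} e0].
have M0 : 0 < cmod (exp_half z) by rewrite cmod_exp_half expR_gt0.
have [d d0 dP] := exp_half_first_order _ (divr_gt0 e0 M0).
apply/near0_complex; exists d => // h /dP hP.
rewrite exp_halfD.
rewrite (_ : _ - _ = exp_half z * (exp_half h - 1 - h * Complex 0 (- 2^-1))); last by ring.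
rewrite !normr_cmod -[Complex e 0]/(e%:C%C) -rmorphM lecR cmodM.
by rewrite mulrC -ler_pdivlMr // mulrAC.
Qed.

End Derivative.

(** * Second differences over a unit square *)

Section MixedDifference.
Context {R : realType}.
Local Notation mu := (@lebesgue_measure R).
Local Notation plane := (measurableTypeR R * measurableTypeR R)%type.

Lemma is_derive_continuous (f : R -> R) (f' : R -> R) :
  (forall t : R, is_derive t 1 f (f' t)) -> continuous f.
Proof.
by move=> df t; apply/differentiable_continuous/derivable1_diffP; have [] := df t.
Qed.

Lemma integral_derivative (f f' : R -> R) (a b : R) : a < b ->
  (forall t : R, is_derive t 1 f (f' t)) -> continuous f' ->
  (\int[mu]_(t in `[a, b]) (f' t)%:E = (f b - f a)%:E)%E.
Proof.
move=> ab df cf'; have cf := is_derive_continuous _ _ df.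
rewrite (continuous_FTC2 (F := f) ab) ?EFinB //.
- exact: continuous_subspaceT.
- split => [t _||]; first by have [] := df t.
  + by apply: cvg_at_right_filter; exact: cf.
  + by apply: cvg_at_left_filter; exact: cf.
- by move=> t _; rewrite derive1E; have [_] := df t.
Qed.

Lemma continuous_integrable (f : R -> R) (a b : R) :
  continuous f -> mu.-integrable `[a, b] (EFin \o f).
Proof.
move=> cf; apply: continuous_compact_integrable; first exact: segment_compact.
exact: continuous_subspaceT.
Qed.

(** The fundamental theorem of calculus in each variable writes the second difference of [u] as an
    iterated integral of [h]. The majorant [H] is nonnegative and measurable, so Tonelli turns its
    iterated integral into a plane integral. *)
Lemma mixed_difference_le (u v h : R -> R -> R) (H : plane -> R)
    (x x' y y' : R) : x < x' -> y < y' ->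
  (forall s t : R, is_derive s 1 (u^~ t) (v s t)) ->
  (forall s t : R, is_derive t 1 (v s) (h s t)) ->
  (forall t : R, continuous (v^~ t)) ->
  (forall s : R, continuous (h s)) ->
  (forall s : R, continuous (fun t => H (s, t))) ->
  measurable_fun setT H ->
  (forall w, 0 <= H w) -> (forall s t, h s t <= H (s, t)) ->
  ((u x' y' - u x' y - (u x y' - u x y))%:E <=
   \int[mu \x mu]_(w in `[x, x'] `*` `[y, y']) (H w)%:E)%E.
Proof.
move=> xx' yy' du dv cv ch cH mH H0 hH.
pose K : set plane := `[x, x'] `*` `[y, y'].
have mK : measurable K by exact: measurableX.
pose HK : plane -> \bar R := (EFin \o H) \_ K.
have mHK : measurable_fun setT HK.
  by apply/(measurable_restrictT _ mK); apply/measurable_EFinP; exact: measurable_funTS.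
have HK0 w : (0 <= HK w)%E.
  by rewrite /HK patchE; case: ifP => _ //=; rewrite lee_fin.
pose V s := v s y' - v s y.
have cV : continuous V by move=> s; apply: cvgB; exact: cv.
have <- : (\int[mu]_(s in `[x, x']) (V s)%:E =
    (u x' y' - u x' y - (u x y' - u x y))%:E)%E.
  by rewrite (integral_derivative (fun s => u s y' - u s y)).
rewrite [leRHS]integral_mkcond -/HK (fubini_tonelli1 (m1 := mu) (m2 := mu)) //.
pose Phi := fubini_F mu HK.
have mPhi : measurable_fun setT Phi by exact: measurable_fun_fubini_tonelli_F.
have Phi0 s : (0 <= Phi s)%E by apply: integral_ge0.
have PhiE s : s \in `[x, x'] -> Phi s = (\int[mu]_(t in `[y, y']) (H (s, t))%:E)%E.
  move=> sx; rewrite /Phi /fubini_F [RHS]integral_mkcond; apply: eq_integral => t _.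
  rewrite /HK !patchE; congr (if _ then _ else _).
  by rewrite in_setX /= mem_setE sx.
have VPhi s : s \in `[x, x'] -> ((V s)%:E <= Phi s)%E.
  move=> sx; rewrite PhiE // -(integral_derivative (v s) (h s)) //.
  apply: le_integral => [|||t _].
  - exact: (measurable_itv).
  - exact: (continuous_integrable (h s)).
  - exact: (continuous_integrable (fun t => H (s, t))).
  - by rewrite lee_fin.
(* If the integral of [Phi] is infinite the claim is trivial. Otherwise [Phi] is integrable and can
   be compared with [V], which may change sign. *)
have [Poo|] := leP +oo%E (\int[mu]_s Phi s)%E; first by rewrite (le_trans (leey _)).
move=> Pfin.
have iPhi : mu.-integrable setT Phi.
  apply/integrableP; split => //.
  by under eq_integral do rewrite gee0_abs //.
apply: (@le_trans _ _ (\int[mu]_(s in `[x, x']) Phi s)%E); last first.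
  by apply: ge0_subset_integral.
apply: le_integral.
- exact: measurable_itv.
- exact: (continuous_integrable V).
- exact: integrableS iPhi.
- move=> s; rewrite inE /=; exact: VPhi.
Qed.

Local Notation C := R[i].

Definition square_difference (G : C -> C) (z : C) : C :=
  G (z + Complex 1 1) - G (z + 1) - (G (z + Complex 0 1) - G z).

Definition unit_square (z : C) : set plane :=
  `[Re z, Re z + 1] `*` `[Im z, Im z + 1].

Lemma is_derive_x (G : C -> C) (l k : C) (s t : R) :
  is_derive (Complex s t : C^o) 1 (G : C^o -> C^o) l ->
  is_derive s 1 (fun s => Re (k * G (Complex s t))) (Re (k * l)).
Proof.
have e r : Complex r t = Complex 0 t + r%:C%C * 1.
  by apply/eqP; rewrite eq_complex /=; apply/andP; split; apply/eqP; ring.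
rewrite e => /is_derive_line - /(_ k); rewrite mul1r.
by under eq_fun do rewrite -e.
Qed.

Lemma is_derive_y (G : C -> C) (l k : C) (s t : R) :
  is_derive (Complex s t : C^o) 1 (G : C^o -> C^o) l ->
  is_derive t 1 (fun t => Re (k * G (Complex s t))) (Re (k * (Complex 0 1 * l))).
Proof.
have e r : Complex s r = Complex s 0 + r%:C%C * Complex 0 1.
  by apply/eqP; rewrite eq_complex /=; apply/andP; split; apply/eqP; ring.
rewrite e => /is_derive_line - /(_ k).
by under eq_fun do rewrite -e.
Qed.

(** The mixed derivative of Re (k G) is Re (k i g), which [mixed_difference_le] integrates. On a
    square of area 1, a pointwise AM-GM inequality scaled by [d] does the work of Cauchy-Schwarz. *)
Lemma square_difference_bound (G G1 g g' : C -> C) (z : C) (d : R) :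
  (forall z, is_derive (z : C^o) 1 (G : C^o -> C^o) (G1 z)) ->
  (forall z, is_derive (z : C^o) 1 (G1 : C^o -> C^o) (g z)) ->
  (forall z, is_derive (z : C^o) 1 (g : C^o -> C^o) (g' z)) ->
  measurable_fun [set: plane] (fun w : plane => cmod (g (Complex w.1 w.2)) ^+ 2) ->
  0 < d ->
  (\int[mu \x mu]_(w in unit_square z)
      (cmod (g (Complex w.1 w.2)) ^+ 2)%:E <= (d ^+ 2)%:E)%E ->
  cmod (square_difference G z) <= d.
Proof.
move=> dG dG1 dg mg d0 gd; set D := square_difference G z.
have [->|D0] := eqVneq D 0.
  by rewrite (eqP (_ : cmod 0 == 0)) ?cmod_eq0 // ltW.
have cD : 0 < cmod D by rewrite cmod_gt0.
(* Testing against the conjugate of [D] reduces to the real function Re (k G). *)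
pose k := conjc D.
have kD : cmod k = cmod D by rewrite !cmodE /k; case: (D) => a b /=; rewrite sqrrN.
pose g2 (w : plane) := cmod (g (Complex w.1 w.2)) ^+ 2.
have g20 w : 0 <= g2 w by exact: sqr_ge0.
(* These coefficients make c |g|^2 + c' a majorant of |D| |g|, while c d^2 + c' = d |D|; dividing by
   |D| at the end leaves |D| <= d. *)
pose c := (2 * d)^-1 * cmod D; pose c' := d / 2 * cmod D.
have c0 : 0 <= c by rewrite mulr_ge0 ?invr_ge0 ?mulr_ge0 ?ltW.
have c'0 : 0 <= c' by rewrite mulr_ge0 ?mulr_ge0 ?ltW.
pose H w := c * g2 w + c'.
have cgr q s : continuous (fun t => Re (q * g (Complex s t))).
  apply: (is_derive_continuous _ (fun t => Re (q * (Complex 0 1 * g' (Complex s t))))).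
  by move=> t; exact: is_derive_y.
have cH s : continuous (fun t => H (s, t)).
  have cr := cgr 1 s; have ci := cgr (Complex 0 (-1)) s.
  move=> t; apply: cvgD; last exact: cvg_cst.
  apply: cvgM; first exact: cvg_cst.
  rewrite /g2; under eq_fun do rewrite /= sqr_cmod !expr2.
  have eI (w : C) : Im w = Re (Complex 0 (-1) * w) by case: w => a b /=; ring.
  have eR (w : C) : Re w = Re (1 * w) by rewrite mul1r.
  under eq_fun do rewrite eI eR.
  rewrite /= sqr_cmod !expr2 eI eR.
  by apply: cvgD; apply: cvgM; (exact: cr || exact: ci).
have mH : measurable_fun [set: plane] H.
  by apply: measurable_funD => //; exact: measurable_funM.
have hH s t : Re (k * (Complex 0 1 * g (Complex s t))) <= H (s, t).
  rewrite (le_trans (ler_norm _)) // (le_trans (Re_le_cmod _)) // !cmodM kD.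
  rewrite (cmodE (Complex 0 1)) /= expr0n /= add0r expr1n sqrtr1 mul1r.
  rewrite /H /c /c' /g2 /= mulrC mulrAC -mulrDl ler_wpM2r ?(ltW cD) //.
  set r := cmod _.
  (* AM-GM: [r <= (r^2 / d + d) / 2] *)
  have -> : (2 * d)^-1 * r ^+ 2 + d / 2 = r + (r - d) ^+ 2 / (2 * d).
    by field; rewrite gt_eqF.
  by rewrite lerDl divr_ge0 ?sqr_ge0 ?mulr_ge0 ?(ltW d0).
have lt1 (a : R) : a < a + 1 by rewrite ltrDl.
pose u s t := Re (k * G (Complex s t)).
pose v s t := Re (k * G1 (Complex s t)).
pose h s t := Re (k * (Complex 0 1 * g (Complex s t))).
have du (s t : R) : is_derive s 1 (u^~ t) (v s t) by exact: is_derive_x.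
have dv (s t : R) : is_derive t 1 (v s) (h s t) by exact: is_derive_y.
have := @mixed_difference_le u v h H
  (Re z) (Re z + 1) (Im z) (Im z + 1) (lt1 _) (lt1 _) du dv.
rewrite -/(unit_square z) /u.
have -> : Re (k * G (Complex (Re z + 1) (Im z + 1))) -
    Re (k * G (Complex (Re z + 1) (Im z))) -
    (Re (k * G (Complex (Re z) (Im z + 1))) - Re (k * G (Complex (Re z) (Im z)))) =
    cmod D ^+ 2.
  rewrite sqr_cmod.
  have -> : Re D ^+ 2 + Im D ^+ 2 = Re (k * D).
    by rewrite cReM /k; case: (D) => a b /=; ring.
  rewrite /D /square_difference.
  have -> : Complex (Re z + 1) (Im z + 1) = z + Complex 1 1.
    by apply/eqP; rewrite eq_complex cReD cImD /= !eqxx.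
  have -> : Complex (Re z + 1) (Im z) = z + 1.
    by apply/eqP; rewrite eq_complex cReD cImD /= addr0 !eqxx.
  have -> : Complex (Re z) (Im z + 1) = z + Complex 0 1.
    by apply/eqP; rewrite eq_complex cReD cImD /= addr0 !eqxx.
  have -> : Complex (Re z) (Im z) = z by case: (z).
  by rewrite !mulrBr !(cReD, cReN).
have H0 w : 0 <= H w by apply: addr_ge0 => //; exact: mulr_ge0.
have cv t : continuous (v^~ t).
  apply: (is_derive_continuous _ (fun s => Re (k * g (Complex s t)))).
  by move=> s; exact: is_derive_x.
have ch s : continuous (h s).
  by rewrite /h; under eq_fun do rewrite mulrA; exact: cgr.
move=> /(_ cv ch cH mH H0 hH).
have mK : measurable (unit_square z) by exact: measurableX.
rewrite /H; under eq_integral do rewrite EFinD EFinM.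
rewrite ge0_integralD //; last 2 first.
- by move=> w _; rewrite -EFinM lee_fin mulr_ge0.
- by apply/measurable_EFinP; apply: measurable_funTS; exact: measurable_funM.
rewrite ge0_integralZl_EFin //; last 2 first.
- by move=> w _; rewrite lee_fin.
- by apply/measurable_EFinP; exact: measurable_funTS.
rewrite integral_cst //.
rewrite [X in (_ <= _ + _ * X)%E](_ : _ = 1%E); last first.
  have mu1 (a : R) : mu `[a, a + 1] = 1%E.
    rewrite lebesgue_measure_itv /= lte_fin lt1 -EFinD; congr EFin; lra.
  rewrite [LHS]product_measure1E //.
  pose A := `[Re z, Re z + 1]%classic; pose B := `[Im z, Im z + 1]%classic.
  transitivity (mu A * mu B)%E => //.
  by rewrite !mu1 mule1.
rewrite mule1 => le_int.
have : ((cmod D ^+ 2)%:E <= c%:E * (d ^+ 2)%:E + c'%:E)%E.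
  apply: le_trans le_int _; rewrite leeD2r //; exact: lee_wpmul2l.
rewrite -EFinM -EFinD lee_fin /c /c'.
have -> : (2 * d)^-1 * cmod D * d ^+ 2 + d / 2 * cmod D = d * cmod D.
  by field; rewrite gt_eqF.
by rewrite expr2 ler_pM2r.
Qed.

End MixedDifference.

(** * Exponentials against powers *)

Section ExpBounds.
Context {R : realType}.
Implicit Types (t y c : R).

(** The single term s^(m+1) / (m+1)! of the exponential series at s = c (1 + t) is enough. *)
Lemma expr1D_le_expR (m : nat) c : 0 < c ->
  exists2 A : R, 0 < A & forall t, 0 <= t -> (1 + t) ^+ m <= A * expR (c * t).
Proof.
move=> c0; exists (m.+1`!%:R / c ^+ m.+1 * expR c) => [|t t0].
  by rewrite mulr_gt0 ?expR_gt0 // divr_gt0 ?exprn_gt0 // ltr0n fact_gt0.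
have h := expR_ge1Dxn m (mulr_ge0 (ltW c0) (addr_ge0 ler01 t0)).
rewrite (_ : _ * expR (c * t) = m.+1`!%:R * expR (c * (1 + t)) / c ^+ m.+1); last first.
  by rewrite [c * (1 + t)]mulrDr mulr1 expRD; ring.
rewrite ler_pdivlMr ?exprn_gt0 //.
apply: (@le_trans _ _ ((c * (1 + t)) ^+ m.+1)).
  rewrite exprMn mulrC ler_pM2l ?exprn_gt0 //.
  by rewrite exprS ler_peMl ?exprn_ge0 ?addr_ge0 // lerDl.
rewrite -ler_pdivrMl ?ltr0n ?fact_gt0 // mulrC; apply: le_trans h.
by rewrite lerDr.
Qed.

Lemma expR_half_le2 : expR (2^-1 : R) <= 2.
Proof.
have := expR_ge1Dx (- 2^-1 : R).
rewrite expRN => h; rewrite -[leRHS]invrK -[leLHS]invrK lef_pV2 ?posrE ?invr_gt0 ?expR_gt0 //.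
by apply: le_trans h; lra.
Qed.

Lemma expr1D_lt_expR (m : nat) (A : R) : exists2 y, 0 <= y &
  A * (1 + y) ^+ m * expR (8^-1 * y) < expR (2^-1 * y).
Proof.
wlog A0 : A / 0 < A.
  move=> H; have [/H //|A0] := ltP 0 A.
  exists 0 => //; rewrite addr0 expr1n mulr0 mulr1 !mulr0 expR0 mulr1.
  exact: le_lt_trans ltr01.
have c0 : 0 < 8^-1 :> R by [].
have [B B0 BP] := expr1D_le_expR m _ c0.
(* The exponent splits as 1/2 = 1/8 + 1/8 + 1/4: one eighth absorbs the power of 1 + y, one is in
   the statement, and e^(y/4) >= 1 + y/4 = 1 + A B beats the constant A B. *)
exists (4 * (A * B)) => [|]; first by rewrite !mulr_ge0 // ltW.
set y := 4 * _; have y0 : 0 <= y by rewrite !mulr_ge0 // ltW.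
apply: (@le_lt_trans _ _ (A * (B * expR (8^-1 * y)) * expR (8^-1 * y))).
  by rewrite ler_pM2r ?expR_gt0 // ler_pM2l // BP.
rewrite -!mulrA -expRD mulrA.
have -> : expR (2^-1 * y) = expR (4^-1 * y) * expR (8^-1 * y + 8^-1 * y).
  by rewrite -expRD; congr expR; lra.
rewrite ltr_pM2r ?expR_gt0 //; apply: lt_le_trans (expR_ge1Dx _).
by rewrite /y mulKf ?pnatr_eq0 // ltrDr.
Qed.

End ExpBounds.

(** * The comparison product *)

Section ComparisonProduct.
Context {R : realType}.
Local Notation C := R[i].
Variable n : nat -> nat.

(** The only zero is -i 2^j, in the lower half plane. *)
Definition comparison_factor (j : nat) : {poly C} :=
  1 - (Complex 0 (2 ^- j)) *: 'X.

(** The exponent is doubled because it is the squared modulus of the factor that is at least 2 at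
    real points with |x| >= 2^j. *)
Definition comparison_product (N : nat) : {poly C} :=
  \prod_(j < N) comparison_factor j ^+ (2 * n j).

Local Notation E := comparison_product.
Local Notation F j z := ((comparison_factor j).[z]).

Lemma comparison_factorE j (z : C) :
  cmod (F j z) ^+ 2 = (1 + Im z / 2 ^+ j) ^+ 2 + (Re z / 2 ^+ j) ^+ 2.
Proof.
rewrite /comparison_factor hornerD hornerN hornerZ hornerX -[1]/(1%:P) hornerC.
rewrite sqr_cmod; case: z => x y /=; ring.
Qed.

Lemma comparison_factor_ge (j : nat) (z : C) : 0 <= Im z ->
  1 <= cmod (F j z) /\ cmod z / 2 ^+ j <= cmod (F j z).
Proof.
move=> z0; have b0 : 0 <= Im z / 2 ^+ j by rewrite divr_ge0 // exprn_ge0.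
split; rewrite -(ler_pXn2r (n:=2)) ?nnegrE ?cmod_ge0 ?divr_ge0 ?cmod_ge0 ?exprn_ge0 //;
  rewrite comparison_factorE.
  by rewrite expr1n; have := sqr_ge0 (Re z / 2 ^+ j); nra.
rewrite exprMn sqr_cmod mulrDl -!exprMn; nra.
Qed.

Lemma cmod_comparison_product N (z : C) :
  cmod (E N).[z] = \prod_(j < N) cmod (F j z) ^+ (2 * n j).
Proof.
rewrite horner_prod (big_morph (@cmod R) cmodM (@ComplexField.Normc.normc1 R)).
by apply: eq_bigr => j _; rewrite horner_exp cmodX.
Qed.

Lemma comparison_product_ge1 N (z : C) : 0 <= Im z -> 1 <= cmod (E N).[z].
Proof.
move=> z0; rewrite cmod_comparison_product; elim/big_ind: _ => // [u v u1 v1|j _].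
  by rewrite -[1]mul1r ler_pM.
by rewrite exprn_ege1 //; have [] := comparison_factor_ge j z z0.
Qed.

Lemma comparison_product_homo N d (z : C) : 0 <= Im z -> (d <= N)%N ->
  cmod (E d).[z] <= cmod (E N).[z].
Proof.
move=> z0 dN; rewrite -(subnKC dN) !cmod_comparison_product big_split_ord /=.
rewrite ler_peMr ?prodr_ge0 // => [i _|]; first by rewrite exprn_ge0 // cmod_ge0.
elim/big_ind: _ => // [u v u1 v1|j _]; first by rewrite -[1]mul1r ler_pM.
by rewrite exprn_ege1 //; have [] := comparison_factor_ge (d + j) z z0.
Qed.

Hypothesis n_gt0 : forall j, (0 < n j)%N.

(** Each of the first [d] factors is at least |z| / 2^d and the others are at least 1. With [d]
    above the degree of a polynomial, the product dominates it far away. *)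
Lemma comparison_product_growth N d (z : C) : 0 <= Im z -> (d <= N)%N ->
  (cmod z / 2 ^+ d) ^+ d <= cmod (E N).[z].
Proof.
move=> z0 dN; apply: le_trans (comparison_product_homo _ _ z z0 dN).
rewrite cmod_comparison_product -[X in _ ^+ X]card_ord -prodr_const.
apply: ler_prod => j _; rewrite divr_ge0 ?cmod_ge0 ?exprn_ge0 //=.
have [F1 F2] := comparison_factor_ge j z z0.
apply: (@le_trans _ _ (cmod (F j z))).
  apply: le_trans F2; rewrite ler_wpM2l ?cmod_ge0 //.
  rewrite lef_pV2 ?posrE ?exprn_gt0 //.
  by rewrite ler_eXn2l ?ltr1n // ltnW // ltn_ord.
by rewrite -{1}[cmod _]expr1 ler_weXn2l // muln_gt0 n_gt0.
Qed.

Lemma comparison_product_real N j (x : R) : (j < N)%N -> 2 ^+ j <= `|x| ->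
  2 ^+ n j <= cmod (E N).[x%:C%C].
Proof.
move=> jN jx; have x0 : 0 <= Im (x%:C%C : C) by [].
rewrite cmod_comparison_product (bigD1 (Ordinal jN)) //=.
apply: (@le_trans _ _ (cmod (F j x%:C%C) ^+ (2 * n j))); last first.
  rewrite ler_peMr ?exprn_ge0 ?cmod_ge0 //.
  elim/big_ind: _ => // [u v u1 v1|i _]; first by rewrite -[1]mul1r ler_pM.
  by rewrite exprn_ege1 //; have [] := comparison_factor_ge i _ x0.
rewrite exprM lerXn2r ?nnegrE ?exprn_ge0 ?cmod_ge0 //.
rewrite comparison_factorE /= mul0r addr0 expr1n -[2]/(1 + 1) lerD2l.
rewrite -real_normK ?num_real // exprn_ege1 // normrM normfV.
by rewrite [`|_ ^+ j|]ger0_norm ?exprn_ge0 // ler_pdivlMr ?exprn_gt0 // mul1r.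
Qed.

(** Factors of index below some K are at most 1 + y and give the power of 1 + y. The later ones are
    bounded by 1 + t <= e^t, and their exponents have a geometric sum of ratio W/2 < 1. K depends on
    [W] alone, so [M] is uniform in [N]. *)
Lemma comparison_product_imaginary (W : R) : 0 < W < 2 ->
  (forall j, (n j)%:R <= 8 * W ^+ j) ->
  exists M : nat, forall N (y : R), 0 <= y ->
    cmod (E N).[Complex 0 y] <= (1 + y) ^+ M * expR (8^-1 * y).
Proof.
move=> /andP[W0 W2] nW; pose r := W / 2.
have r0 : 0 < r by rewrite divr_gt0.
have r1 : r < 1 by rewrite ltr_pdivrMr // mul1r.
(* Here 16 = 2 * 8 comes from the exponent [2 * n j] and the bound 8 W^j on [n j]. *)
have [K KP] : exists K, 16 * r ^+ K / (1 - r) <= 8^-1.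
  have e0 : 0 < (1 - r) / 128 by rewrite divr_gt0 ?subr_gt0.
  have : (1 * r ^+ k @[k --> \oo] --> (0:R)).
    by apply: cvg_geometric; rewrite ger0_norm // ltW.
  move=> /cvgrPdist_le /(_ _ e0) [K _ /(_ K (leqnn K))].
  rewrite /= sub0r normrN mul1r ger0_norm ?exprn_ge0 ?(ltW r0) // => rK.
  by exists K; rewrite ler_pdivrMr ?subr_gt0 //; lra.
exists (\sum_(j < K) 2 * n j)%N => N y y0.
have Fy j : cmod (F j (Complex 0 y)) = 1 + y / 2 ^+ j.
  apply/eqP; rewrite -(eqrXn2 (n:=2)) ?cmod_ge0 ?addr_ge0 ?divr_ge0 ?exprn_ge0 //.
  by rewrite comparison_factorE /= mul0r expr0n addr0.
(* With K + N factors the split at K makes sense even if N < K; extra factors only increase the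
   modulus. *)
apply: le_trans (comparison_product_homo (K + N) N _ _ (leq_addl _ _)) _ => //.
rewrite cmod_comparison_product big_split_ord /=.
apply: ler_pM; rewrite ?prodr_ge0 //.
- by move=> i _; rewrite exprn_ge0 ?cmod_ge0.
- by move=> i _; rewrite exprn_ge0 ?cmod_ge0.
- rewrite expr_sum; apply: ler_prod => j _.
  rewrite exprn_ge0 ?cmod_ge0 //= lerXn2r ?nnegrE ?cmod_ge0 ?addr_ge0 //.
  by rewrite Fy lerD2l ler_piMr // invf_le1 ?exprn_gt0 // exprn_ege1 // ler1n.
apply: (@le_trans _ _ (\prod_(i < N) expR (16 * y * r ^+ (K + i)))).
  apply: ler_prod => i _; rewrite exprn_ge0 ?cmod_ge0 //= Fy.
  apply: (@le_trans _ _ (expR (y / 2 ^+ (K + i)) ^+ (2 * n (K + i)%N))).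
    rewrite lerXn2r ?nnegrE ?expR_ge0 ?addr_ge0 ?divr_ge0 ?exprn_ge0 //.
    exact: expR_ge1Dx.
  rewrite -expRM_natl ler_expR /r expr_div_n mulrA.
  rewrite mulrA ler_wpM2r ?invr_ge0 ?exprn_ge0 //.
  by have := nW (K + i)%N; rewrite natrM; nra.
rewrite -expR_sum ler_expR -mulr_sumr.
under eq_bigr do rewrite exprD.
rewrite -mulr_sumr.
have gs : \sum_(i < N) r ^+ i <= (1 - r)^-1.
  rewrite -[leRHS]mul1r ler_pdivlMr ?subr_gt0 //.
  have := subrX1 r N; have := exprn_ge0 N (ltW r0).
  set s := \sum_(i < N) _; nra.
apply: (@le_trans _ _ (y * (16 * r ^+ K / (1 - r)))).
  rewrite [16 * y]mulrC -!mulrA; apply: ler_wpM2l => //.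
  apply: ler_wpM2l => //; apply: ler_wpM2l => //.
  by rewrite exprn_ge0 // ltW.
by rewrite mulrC ler_wpM2r.
Qed.

End ComparisonProduct.

(** * Membership in the weighted space *)

Section Integrability.
Context {R : realType}.
Local Notation C := R[i].
Local Notation mu := (@lebesgue_measure R).
Local Notation plane := (measurableTypeR R * measurableTypeR R)%type.

Definition measurable_ReIm (g : C -> C) :=
  measurable_fun [set: plane] (fun w : plane => Re (g (Complex w.1 w.2))) /\
  measurable_fun [set: plane] (fun w : plane => Im (g (Complex w.1 w.2))).

Lemma measurable_sqr_cmod (g : C -> C) : measurable_ReIm g ->
  measurable_fun [set: plane] (fun w : plane => cmod (g (Complex w.1 w.2)) ^+ 2).
Proof.
move=> [mr mi]; under eq_fun do rewrite sqr_cmod.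
by apply: measurable_funD; exact: measurable_funX.
Qed.

Lemma measurable_ReIm_sub (f g : C -> C) :
  measurable_ReIm f -> measurable_ReIm g -> measurable_ReIm (fun z => f z - g z).
Proof.
move=> [fr fi] [gr gi]; split.
  by under eq_fun do rewrite cReD cReN; exact: measurable_funB.
by under eq_fun do rewrite cImD cImN; exact: measurable_funB.
Qed.

Lemma measurable_ReIm_horner (q : {poly C}) : measurable_ReIm (horner q).
Proof.
apply: (@horner_ReIm R plane (fun u => measurable_fun [set: plane] u)).
- by move=> c; exact: measurable_cst.
- by move=> u v; exact: measurable_funD.
- by move=> u v; exact: measurable_funM.
- exact: measurable_fst.
- exact: measurable_snd.
Qed.

Lemma measurable_ReIm_exp_half : measurable_ReIm exp_half.
Proof.
have m1 : measurable_fun [set: plane] (fun w : plane => w.1 / 2).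
  by apply: measurable_funM => //; exact: measurable_fst.
have m2 : measurable_fun [set: plane] (fun w : plane => expR (w.2 / 2)).
  apply: (measurableT_comp (@measurable_expR R)).
  by apply: measurable_funM => //; exact: measurable_snd.
have mc : measurable_fun [set: R] (@cos R).
  by apply: continuous_measurable_fun; exact: continuous_cos.
have ms : measurable_fun [set: R] (@sin R).
  by apply: continuous_measurable_fun; exact: continuous_sin.
split => /=.
  by apply: measurable_funM => //; exact: measurableT_comp mc m1.
apply: (measurableT_comp (@oppr_measurable R _)).
by apply: measurable_funM => //; exact: measurableT_comp ms m1.
Qed.

Lemma measurable_expR_weight (p : R) :
  measurable_fun [set: plane] (fun w : plane => expR (- weight p (Complex w.1 w.2))).
Proof.
apply: (measurableT_comp (@measurable_expR R)).
apply: (measurableT_comp (@oppr_measurable R _)).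
apply: measurable_funD; first exact: (measurableT_comp (@normr_measurable R _) measurable_snd).
have ms : measurable_fun [set: R] (@Num.sqrt R).
  by apply: continuous_measurable_fun; exact: sqrt_continuous.
have mc : measurable_fun [set: plane] (fun w : plane => w.1 ^+ 2 + w.2 ^+ 2).
  apply: measurable_funD; apply: measurable_funX.
    exact: measurable_fst.
  exact: measurable_snd.
exact: measurableT_comp (measurable_powR p) (measurableT_comp ms mc).
Qed.

Lemma measurable_H2_density (p : R) (g : C -> C) : measurable_ReIm g ->
  measurable_fun [set: plane] (fun w : plane =>
    cmod (g (Complex w.1 w.2)) ^+ 2 * expR (- weight p (Complex w.1 w.2))).
Proof.
move=> mg; apply: measurable_funM; first exact: measurable_sqr_cmod.
exact: measurable_expR_weight.
Qed.

Lemma integral_oneDsqrV : (\int[mu]_x ((oneDsqr x)^-1)%:E = (pi : R)%:E)%E.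
Proof.
rewrite ge0_symfun_integralT.
- rewrite -set_itvcy integral0y_oneDsqr -EFinM; congr EFin.
  by rewrite mulrC divfK.
- by move=> x; rewrite invr_ge0 ltW // oneDsqr_gt0.
- exact: continuous_oneDsqrV.
- by move=> x /=; rewrite /oneDsqr sqrrN.
Qed.

Lemma integral_plane_oneDsqrV (A : R) : 0 <= A ->
  (\int[mu \x mu]_w (A * ((oneDsqr w.1)^-1 * (oneDsqr w.2)^-1))%:E < +oo)%E.
Proof.
move=> A0; have mo : measurable_fun [set: R] (fun x : R => (oneDsqr x)^-1).
  by apply: continuous_measurable_fun; exact: continuous_oneDsqrV.
have o0 (x : R) : 0 <= (oneDsqr x)^-1 by rewrite invr_ge0 ltW // oneDsqr_gt0.
rewrite (fubini_tonelli1 (m1 := mu) (m2 := mu)); last 2 first.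
- apply/measurable_EFinP; apply: measurable_funM => //.
  apply: measurable_funM.
    exact: measurableT_comp mo measurable_fst.
  exact: measurableT_comp mo measurable_snd.
- by move=> w; rewrite lee_fin !mulr_ge0.
rewrite (eq_integral (fun x : measurableTypeR R => ((A * pi) * (oneDsqr x)^-1)%:E)) => [|x _].
  under eq_integral do rewrite EFinM.
  rewrite ge0_integralZl_EFin //.
  - by rewrite integral_oneDsqrV -EFinM ltry.
  - exact/measurable_EFinP.
  - by rewrite mulr_ge0 // pi_ge0.
rewrite /fubini_F /=.
under eq_integral do rewrite mulrA EFinM.
rewrite ge0_integralZl_EFin ?mulr_ge0 //.
- by rewrite integral_oneDsqrV -EFinM; congr EFin; ring.
- exact/measurable_EFinP.
Qed.

(** For t > 1, t^m <= (t^p)^n once m <= p n, and [expr1D_le_expR] applies to t^p. For t <= 1 the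
    constant 2^m suffices. *)
Lemma expr1D_le_expR_powR (p : R) (m : nat) : 0 < p ->
  exists2 A : R, 0 < A & forall t, 0 <= t -> (1 + t) ^+ m <= A * expR (t `^ p).
Proof.
move=> p0; have c1 : 0 < 1 :> R by [].
pose n := (Num.truncn (m%:R / p)).+1.
have mn : m%:R <= p * n%:R.
  by rewrite mulrC -ler_pdivrMr // ltW // truncnS_gt.
have [A A0 AP] := expr1D_le_expR n 1 c1.
exists (2 ^+ m * (1 + A)) => [|t t0]; first by rewrite mulr_gt0 ?exprn_gt0 ?addr_gt0.
have E1 : 1 <= expR (t `^ p) by rewrite -expR0 ler_expR powR_ge0.
have [t1|t1] := leP t 1.
  apply: (@le_trans _ _ (2 ^+ m)).
    by rewrite lerXn2r ?nnegrE ?addr_ge0 //; lra.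
  rewrite -mulrA ler_peMr ?exprn_ge0 //.
  by rewrite mulr_ege1 // lerDl ltW.
apply: (@le_trans _ _ (2 ^+ m * t ^+ m)).
  by rewrite -exprMn lerXn2r ?nnegrE ?addr_ge0 ?mulr_ge0 //; lra.
rewrite -mulrA ler_pM2l ?exprn_gt0 //.
apply: (@le_trans _ _ ((t `^ p) ^+ n)).
  rewrite -!powR_mulrn ?powR_ge0 // -powRrM ler_powR //; exact: ltW.
have := AP _ (powR_ge0 t p); rewrite mul1r; move=> AP'.
apply: (@le_trans _ _ ((1 + t `^ p) ^+ n)).
  by rewrite lerXn2r ?nnegrE ?addr_ge0 ?powR_ge0 // lerDr.
apply: le_trans AP' _; rewrite ler_wpM2r ?expR_ge0 // lerDr //.
Qed.

(** The factor e^|Im z| cancels against the weight, and e^(-|z|^p) absorbs m + 4 powers of 1 + |z|;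
    four of them pay for the integrable majorant 1 / ((1 + x^2)(1 + y^2)). *)
Lemma H2_sqnorm_lty (p : R) (g : C -> C) (A : R) (m : nat) : 0 < p ->
  measurable_ReIm g -> 0 <= A ->
  (forall z, cmod (g z) ^+ 2 <= A * (1 + cmod z) ^+ m * expR `|Im z|) ->
  (H2_sqnorm (weight p) g < +oo)%E.
Proof.
move=> p0 mg A0 gA; have [B B0 BP] := expr1D_le_expR_powR p (m + 4) p0.
apply: le_lt_trans (integral_plane_oneDsqrV (A * B) (mulr_ge0 A0 (ltW B0))).
rewrite /H2_sqnorm /cintegral; apply: ge0_le_integral => //.
- by move=> w _; rewrite lee_fin mulr_ge0 ?sqr_ge0 ?expR_ge0.
- by apply/measurable_EFinP; exact: measurable_H2_density.
- have mo : measurable_fun [set: R] (fun x : R => (oneDsqr x)^-1).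
    by apply: continuous_measurable_fun; exact: continuous_oneDsqrV.
  apply/measurable_EFinP; apply: measurable_funM => //; apply: measurable_funM.
    exact: measurableT_comp mo measurable_fst.
  exact: measurableT_comp mo measurable_snd.
move=> [x y] _; rewrite lee_fin /=; set z := Complex x y.
have z0 := cmod_ge0 z; have z1 : 0 <= 1 + cmod z by rewrite addr_ge0.
rewrite -invfM ler_pdivlMr ?mulr_gt0 ?oneDsqr_gt0 //.
have xy : oneDsqr x * oneDsqr y <= (1 + cmod z) ^+ 4.
  have h : cmod z ^+ 2 = x ^+ 2 + y ^+ 2 by rewrite sqr_cmod.
  rewrite (_ : _ ^+ 4 = (1 + cmod z) ^+ 2 * (1 + cmod z) ^+ 2); last by ring.
  by rewrite ler_pM ?(ltW (oneDsqr_gt0 _)) // /oneDsqr;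
     have := sqr_ge0 x; have := sqr_ge0 y; nra.
apply: (@le_trans _ _ (A * (1 + cmod z) ^+ m * expR `|Im z| *
    expR (- weight p z) * (1 + cmod z) ^+ 4)).
  apply: ler_pM => //.
  - by rewrite mulr_ge0 ?sqr_ge0 ?expR_ge0.
  - by rewrite ler_wpM2r ?expR_ge0.
rewrite /weight opprD expRD.
rewrite (_ : _ * _ = A * ((1 + cmod z) ^+ (m + 4) * expR (- cmod z `^ p)) *
   (expR `|Im z| * expR (- `|Im z|))); last by rewrite exprD; ring.
rewrite expRxMexpNx_1 mulr1 ler_wpM2l // expRN ler_pdivrMr ?expR_gt0 //.
exact: BP.
Qed.

Lemma horner_growth (q : {poly C}) : exists A : R, exists2 n : nat, 0 <= A &
  forall z, cmod q.[z] <= A * (1 + cmod z) ^+ n.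
Proof.
elim/poly_ind: q => [|q c [A [n A0 AP]]].
  exists 0, 0%N => // z; rewrite horner0 mul0r.
  by rewrite (eqP (_ : cmod 0 == 0)) ?cmod_eq0.
exists (A + cmod c), n.+1 => [|z]; first by rewrite addr_ge0 ?cmod_ge0.
rewrite !hornerE (le_trans (cmodD _ _)) // cmodM mulrDl.
have z1 : 1 <= 1 + cmod z by rewrite lerDl cmod_ge0.
apply: lerD.
  rewrite exprSr mulrA ler_pM ?cmod_ge0 // lerDr //.
by rewrite ler_peMr ?cmod_ge0 // exprn_ege1.
Qed.

End Integrability.

(** * Polynomials with subexponential growth on the real line *)

Section PolynomialGrowth.
Context {R : realType}.
Local Notation C := R[i].
Variable p : R.
Hypotheses (p0 : 0 < p) (p1 : p < 1).

(* Chosen so that on 2^j <= |x| < 2^(j+1) the j-th factor alone already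
   dominates exp((|x|+2)^p/2). *)
Definition multiplicity (j : nat) : nat :=
  (Num.truncn ((2 : R) `^ p ^+ (j + 2))).+1.

(** The upper bound, from p < 1, makes the sum of n_j / 2^j converge. *)
Lemma powR2_itv : 1 <= (2 : R) `^ p < 2.
Proof.
apply/andP; split; first by rewrite -[leLHS](powRr0 2) ler_powR ?ler1n // ltW.
rewrite /powR gt_eqF // -[ltRHS]lnK ?posrE // ltr_expR gtr_pMl //.
by rewrite ln_gt0 // ltr1n.
Qed.

Lemma multiplicity_ge j : (2 : R) `^ p ^+ (j + 2) <= (multiplicity j)%:R.
Proof. by rewrite ltW // truncnS_gt. Qed.

Lemma multiplicity_le j : (multiplicity j)%:R <= 8 * (2 : R) `^ p ^+ j.
Proof.
have /andP[W1 W2] := powR2_itv; set W := 2 `^ p in W1 W2 *.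
have Wj : 1 <= W ^+ j by rewrite exprn_ege1.
have : (Num.truncn (W ^+ (j + 2)))%:R <= W ^+ (j + 2).
  by rewrite truncn_le exprn_ge0 // (le_trans ler01).
have W24 : W ^+ j * W ^+ 2 <= W ^+ j * 4.
  by rewrite ler_wpM2l ?(le_trans ler01) //; nra.
by rewrite /multiplicity -natr1 -/W exprD; lra.
Qed.

Lemma dyadic_bracket (x : R) N : 1 <= x -> x < 2 ^+ N ->
  exists2 j, (j < N)%N & 2 ^+ j <= x < 2 ^+ j.+1.
Proof.
elim: N => [|N IH] x1 xN; first by move: x1; rewrite leNgt -[ltRHS](expr0 2) xN.
have [/(IH x1)[j jN jx]|Nx] := ltP x (2 ^+ N); first by exists j => //; exact: ltnW.
by exists N => //; rewrite Nx.
Qed.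

(** For |x| < 1, (|x| + 2)^p <= 3 and the constant suffices. If 2^j <= |x| < 2^(j+1), then |x| + 2
    <= 2^(j+2), and e^(1/2) <= 2 lets the lower bound 2^(n_j) of the product dominate e^(n_j /
    2). *)
Lemma expR_le_comparison_product N (x : R) : `|x| < 2 ^+ N ->
  expR (2^-1 * (`|x| + 2) `^ p) <=
  expR (3 / 2) * cmod (comparison_product multiplicity N).[x%:C%C].
Proof.
move=> xN; have E1 : 1 <= cmod (comparison_product multiplicity N).[x%:C%C].
  exact: comparison_product_ge1.
have [x1|x1] := ltP `|x| 1.
  apply: (@le_trans _ _ (expR (3 / 2))); last by rewrite ler_peMr ?expR_ge0.
  rewrite ler_expR mulrC ler_pM2r //.
  apply: (@le_trans _ _ (`|x| + 2)); last by lra.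
  by rewrite -[leRHS]powRr1 ?addr_ge0 // ler_powR ?(ltW p1) //; have := normr_ge0 x; lra.
have [j jN /andP[jx xj]] := dyadic_bracket _ _ x1 xN.
apply: (@le_trans _ _ (2 ^+ multiplicity j)); last first.
  apply: le_trans (comparison_product_real _ _ _ _ jN jx) _.
  by rewrite ler_peMl ?cmod_ge0 // -expR0 ler_expR.
apply: (@le_trans _ _ (expR (2^-1) ^+ multiplicity j)); last first.
  by rewrite lerXn2r ?nnegrE ?expR_ge0 ?expR_half_le2.
rewrite -expRM_natr ler_expR ler_pM2l //.
apply: le_trans (multiplicity_ge j).
rewrite -powR_mulrn ?powR_ge0 // -powRrM mulrC powRrM powR_mulrn //.
apply: ge0_ler_powR; rewrite ?nnegrE ?addr_ge0 ?exprn_ge0 ?(ltW p0) //.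
have j2 : 1 <= 2 ^+ j :> R by rewrite exprn_ege1 // ler1n.
by move: xj; rewrite exprS addn2 !exprS; lra.
Qed.

(** The degree of [Q] only influences the number of factors in the comparison product, whose bound
    on the imaginary axis is uniform in that number. Hence [M] can be chosen before [B] and [Q]. *)
Lemma polynomial_imaginary_bound : exists M : nat, forall (B : R) (Q : {poly C}),
  0 < B ->
  (forall x : R, cmod Q.[x%:C%C] <= B * expR (2^-1 * (`|x| + 2) `^ p)) ->
  forall y : R, 0 <= y ->
    cmod Q.[Complex 0 y] <= B * expR (3 / 2) * ((1 + y) ^+ M * expR (8^-1 * y)).
Proof.
have /andP[W1 W2] := powR2_itv.
have W02 : 0 < (2 : R) `^ p < 2 by rewrite W2 (lt_le_trans ltr01).
have [M MP] := comparison_product_imaginary _ _ W02 multiplicity_le.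
exists M => B Q B0 QB y y0.
set B' := B * expR (3 / 2).
have B'0 : 0 < B' by rewrite mulr_gt0 ?expR_gt0.
have [A [m A0 AP]] := horner_growth Q.
(* [T] and [X] are chosen so that |z| >= X implies A (2|z|)^m <= B' (|z| / 2^(m+1))^(m+1); the 1 in
   [X] gives 1 + |z| <= 2|z|. *)
pose T := A * 2 ^+ m * (2 ^+ m.+1) ^+ m.+1.
have T0 : 0 <= T by rewrite !mulr_ge0 ?exprn_ge0.
pose X := 1 + T / B'.
have X1 : 1 <= X by rewrite lerDl divr_ge0 // ltW.
(* N >= m + 1 makes the product outgrow [Q] beyond [X], and 2^N >= X brings the real points with |x|
   < X under [expR_le_comparison_product]. *)
pose N := maxn m.+1 (Num.truncn X).+1.
have XN : X <= 2 ^+ N.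
  apply: (@le_trans _ _ (N%:R)).
    by apply: le_trans (ltW (truncnS_gt X)) _; rewrite ler_nat leq_maxr.
  by rewrite -natrX ler_nat ltnW // ltn_expl.
pose E := comparison_product (R := R) multiplicity N.
suff : cmod Q.[Complex 0 y] <= B' * cmod E.[Complex 0 y].
  move/le_trans; apply; rewrite ler_pM2l //; exact: MP.
have far z : 0 <= Im z -> X <= cmod z -> cmod Q.[z] <= B' * cmod E.[z].
  move=> z0 Xz; have z1 : 1 <= cmod z by exact: le_trans Xz.
  apply: le_trans (AP z) _.
  apply: (@le_trans _ _ (A * (2 * cmod z) ^+ m)).
    by apply: ler_wpM2l => //; rewrite lerXn2r ?nnegrE ?addr_ge0 ?mulr_ge0 ?cmod_ge0 //; lra.
  apply: (@le_trans _ _ (B' * (cmod z / 2 ^+ m.+1) ^+ m.+1)); last first.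
    rewrite ler_pM2l //; apply: comparison_product_growth => //.
    exact: leq_maxl.
  rewrite expr_div_n mulrA ler_pdivlMr ?exprn_gt0 // exprMn.
  rewrite [leLHS](_ : _ = T * cmod z ^+ m); last by rewrite /T mulrA mulrAC.
  rewrite exprS mulrA ler_wpM2r ?exprn_ge0 ?cmod_ge0 // mulrC -ler_pdivrMr //.
  by apply: le_trans Xz; rewrite lerDr.
apply: (half_plane_max_principle Q E B' X) => //.
- exact: lt_le_trans X1.
- exact: ltW.
- by move=> z z0; rewrite -cmod_gt0 (lt_le_trans ltr01) // comparison_product_ge1.
- move=> z z0; have [Xz|zX] := leP X (cmod z); first by apply: far => //; rewrite z0.
  have zE : z = (Re z)%:C%C by apply/eqP; rewrite eq_complex /= z0 !eqxx.
  have zn : cmod z = `|Re z| by rewrite cmodE z0 expr0n addr0 sqrtr_sqr.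
  rewrite zE; apply: le_trans (QB _) _.
  rewrite -mulrA ler_pM2l //; apply: expR_le_comparison_product.
  by rewrite -zn; exact: lt_le_trans XN.
Qed.

End PolynomialGrowth.

(** * Polynomials are not dense *)

Section NotDense.
Context {R : realType}.
Local Notation C := R[i].
Local Notation mu := (@lebesgue_measure R).
Local Notation plane := (measurableTypeR R * measurableTypeR R)%type.

Lemma antiderivative_exists (q : {poly C}) : exists P : {poly C}, P^`() = q.
Proof.
(* At i = 0 the coefficient is a division by zero, hence 0; the derivative discards it. *)
exists (\poly_(i < (size q).+1) (q`_i.-1 / i%:R)); apply/polyP => i.
rewrite coef_deriv coef_poly ltnS; case: ltnP => [iq|qi].
  by rewrite -[LHS]mulr_natr divfK // pnatr_eq0.
by rewrite mul0rn nth_default.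
Qed.

Lemma square_difference_horner (P : {poly C}) :
  exists Q : {poly C}, forall z, Q.[z] = square_difference (horner P) z.
Proof.
pose T (a : C) := P \Po ('X + a%:P).
exists (T (Complex 1 1) - T 1 - (T (Complex 0 1) - P)) => z.
by rewrite /square_difference !(hornerE, horner_comp).
Qed.

Let c : C := Complex 0 (- 2^-1).

Let c_neq0 : c != 0.
Proof. by rewrite eq_complex /= oppr_eq0 invr_eq0 pnatr_eq0 andbF. Qed.

(** This is kappa: c^-2 comes from integrating [exp_half] twice, c = -i/2 being its logarithmic
    derivative, and the product from the second difference. *)
Definition square_factor : C :=
  c^-1 ^+ 2 * ((exp_half 1 - 1) * (exp_half (Complex 0 1) - 1)).

Lemma square_difference_exp_half (z : C) :
  square_difference (fun z => c^-1 ^+ 2 * exp_half z) z = square_factor * exp_half z.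
Proof.
rewrite /square_difference /square_factor.
have -> : Complex 1 1 = 1 + Complex 0 1 :> C.
  by apply/eqP; rewrite eq_complex cReD cImD /= addr0 add0r !eqxx.
by rewrite !exp_halfD; ring.
Qed.

(** [exp_half 1] has imaginary part -sin(1/2), and [exp_half] at i has modulus e^(1/2); so neither
    is 1. *)
Lemma square_factor_gt0 : 0 < cmod square_factor.
Proof.
rewrite cmod_gt0 /square_factor mulf_neq0 ?expf_neq0 ?invr_eq0 //.
rewrite mulf_neq0 // subr_eq0; apply/eqP.
  move=> /(congr1 (@Im R)) /= /eqP.
  rewrite mul0r expR0 mul1r oppr_eq0 gt_eqF // sin_gt0_pi //.
  by rewrite divr_gt0 //=; have := @pi_ge2 R; lra.
move=> e1; have := cmod_exp_half (Complex 0 1 : C).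
rewrite e1 [LHS]ComplexField.Normc.normc1 /= mul1r => /esym/eqP.
by rewrite gt_eqF // expR_gt1 invr_gt0.
Qed.

Lemma is_derive_mul_exp_half (k : C) (z : C^o) :
  is_derive z 1 ((fun z => k * exp_half z) : C^o -> C^o) (k * c * exp_half z).
Proof.
have := is_deriveZ k (is_derive_exp_half z).
by rewrite -mulrA.
Qed.

Variable p : R.
Hypotheses (p0 : 0 < p) (p1 : p < 1).

(** Points of the square lie within distance 2 of its corner z, whence the shift by 2. *)
Lemma weight_unit_square (z : C) (w : plane) : 0 <= Im z -> unit_square z w ->
  weight p (Complex w.1 w.2) <= Im z + 1 + (cmod z + 2) `^ p.
Proof.
case: w => s t z0 [/=]; rewrite !in_itv /= => /andP[s1 s2] /andP[t1 t2].
apply: lerD; first by rewrite /= ger0_norm // (le_trans z0).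
apply: ge0_ler_powR; rewrite ?nnegrE ?addr_ge0 ?cmod_ge0 ?(ltW p0) //.
have -> : Complex s t = z + Complex (s - Re z) (t - Im z).
  by apply/eqP; rewrite eq_complex cReD cImD /= !subrKC !eqxx.
apply: le_trans (cmodD _ _) _; rewrite lerD2l.
apply: le_trans (cmod_le_ReIm _) _ => /=.
by rewrite !ger0_norm ?subr_ge0 //; lra.
Qed.

Lemma H2_norm_lt_sqnorm (g : C -> C) (e : R) :
  (H2_norm (weight p) g < e%:E)%E -> (H2_sqnorm (weight p) g <= (e ^+ 2)%:E)%E.
Proof.
have : (0 <= H2_sqnorm (weight p) g)%E.
  by apply: integral_ge0 => w _; rewrite lee_fin mulr_ge0 ?sqr_ge0 ?expR_ge0.
rewrite /H2_norm; case: (H2_sqnorm _ _) => [r| |] //= r0.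
rewrite lte_fin lee_fin => re; rewrite lee_fin in r0.
rewrite -(sqr_sqrtr r0) lerXn2r ?nnegrE ?sqrtr_ge0 ?(ltW re) //.
exact: le_trans (sqrtr_ge0 r) (ltW re).
Qed.

(** The weight is at most [s] on the unit square at z, so the unweighted squared L^2 norm of
    [exp_half] - q there is at most e^s times the squared weighted one, and
    [square_difference_bound] applies with d = e exp(s/2). *)
Lemma square_difference_H2 (q P : {poly C}) (P1 : {poly C}) (e : R) (z : C) :
  P1^`() = q -> P^`() = P1 -> 0 < e -> 0 <= Im z ->
  (H2_norm (weight p) (fun z => exp_half z - q.[z])%R < e%:E)%E ->
  cmod (square_factor * exp_half z - square_difference (horner P) z) <=
  e * expR (2^-1 * (Im z + 1 + (cmod z + 2) `^ p)).
Proof.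
move=> P1q PP1 e0 z0 /H2_norm_lt_sqnorm gle.
set s := Im z + 1 + _.
pose G (z : C) : C := c^-1 ^+ 2 * exp_half z - P.[z].
have -> : square_factor * exp_half z - square_difference (horner P) z =
    square_difference G z.
  by rewrite -square_difference_exp_half /square_difference /G; ring.
pose g (z : C) : C := exp_half z - q.[z].
have mg : measurable_ReIm g.
  exact: measurable_ReIm_sub measurable_ReIm_exp_half (measurable_ReIm_horner q).
have mg2 := measurable_sqr_cmod g mg.
apply: (square_difference_bound G (fun z => c^-1 * exp_half z - P1.[z]) g
  (fun z => c * exp_half z - q^`().[z])).
- move=> w; apply: is_deriveB; last by rewrite -PP1; exact: is_derive_horner.
  have := is_derive_mul_exp_half (c^-1 ^+ 2) w.
  by rewrite expr2 mulfVK.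
- move=> w; apply: is_deriveB; last by rewrite -P1q; exact: is_derive_horner.
  have := is_derive_mul_exp_half (c^-1) w.
  by rewrite mulVf // mul1r.
- move=> w; apply: is_deriveB; last exact: is_derive_horner.
  exact: is_derive_exp_half.
- exact: mg2.
- by rewrite mulr_gt0 ?expR_gt0.
have mK : measurable (unit_square z) by exact: measurableX.
pose k (w : plane) :=
  cmod (g (Complex w.1 w.2)) ^+ 2 * expR (- weight p (Complex w.1 w.2)).
have k0 w : 0 <= k w by rewrite mulr_ge0 ?sqr_ge0 ?expR_ge0.
have mk : measurable_fun [set: plane] k by exact: measurable_H2_density.
apply: (@le_trans _ _ (\int[mu \x mu]_(w in unit_square z) ((expR s)%:E * (k w)%:E))%E).
  apply: ge0_le_integral => //.
  - by move=> w _; rewrite lee_fin sqr_ge0.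
  - by apply/measurable_EFinP; exact: measurable_funTS.
  - apply/measurable_EFinP; apply: measurable_funTS; exact: measurable_funM.
  move=> w wz; rewrite -EFinM lee_fin /k mulrCA -expRD ler_peMr ?sqr_ge0 //.
  rewrite -expR0 ler_expR subr_ge0; exact: weight_unit_square.
rewrite ge0_integralZl_EFin ?expR_ge0 //; last 2 first.
- by move=> w _; rewrite lee_fin.
- by apply/measurable_EFinP; exact: measurable_funTS.
have -> : ((e * expR (2^-1 * s)) ^+ 2)%:E = ((expR s)%:E * (e ^+ 2)%:E)%E.
  rewrite -EFinM; congr EFin; rewrite exprMn mulrC -expRM_natr.
  by congr (expR _ * _); lra.
apply: lee_wpmul2l; first by rewrite lee_fin expR_ge0.
apply: le_trans gle.
rewrite /H2_sqnorm /cintegral.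
apply: ge0_subset_integral => //.
- by apply/measurable_EFinP.
- by move=> w _; rewrite lee_fin.
Qed.

Lemma exp_half_H2 : H2 (weight p) (@exp_half R).
Proof.
split; first by move=> z; have [] := is_derive_exp_half z.
apply: (H2_sqnorm_lty p _ 1 0 p0 measurable_ReIm_exp_half) => // z.
rewrite expr0 !mul1r cmod_exp_half -expRM_natr ler_expR.
by rewrite divfK ?pnatr_eq0 // ler_norm.
Qed.

Lemma horner_H2 (q : {poly C}) : H2 (weight p) (horner q).
Proof.
split; first by move=> z; have [] := is_derive_horner q z.
have [A [n A0 AP]] := horner_growth q.
apply: (H2_sqnorm_lty p _ (A ^+ 2) (n * 2) p0 (measurable_ReIm_horner q)).
  exact: sqr_ge0.
move=> z; apply: (@le_trans _ _ (A ^+ 2 * (1 + cmod z) ^+ (n * 2))).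
  rewrite exprM -exprMn lerXn2r ?nnegrE ?cmod_ge0 //.
  by rewrite mulr_ge0 ?exprn_ge0 ?addr_ge0 ?cmod_ge0.
rewrite ler_peMr -?expR0 ?ler_expR //.
by rewrite mulr_ge0 ?sqr_ge0 ?exprn_ge0 ?addr_ge0 ?cmod_ge0.
Qed.

Lemma polynomials_not_dense : ~ H2_dense (weight p) (@polynomials R).
Proof.
move=> dense; have k0 := square_factor_gt0; set k := cmod square_factor in k0.
have [M MP] := polynomial_imaginary_bound p p0 p1.
(* On the real line [k] is the modulus of kappa f, and the error is at most exp((1 + (|x| + 2)^p) /
   2) because e <= 1. As [B] does not involve q, the point y and then e can be fixed before q. *)
pose B := k + expR 2^-1.
have B0 : 0 < B by rewrite addr_gt0 ?expR_gt0.
pose A := B * expR (3 / 2) / k.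
have [y y0 Ay] := expr1D_lt_expR M A.
pose S := expR (2^-1 * (y + 1 + (y + 2) `^ p)).
have S0 : 0 < S by exact: expR_gt0.
(* [gap] is |kappa f(iy)| minus the bound for |Q(iy)|; [e] keeps the approximation error [e * S] at
   iy below half of it. *)
pose gap := k * (expR (2^-1 * y) - A * (1 + y) ^+ M * expR (8^-1 * y)).
have gap0 : 0 < gap by rewrite mulr_gt0 // subr_gt0.
pose e := Num.min 1 (gap / (2 * S)).
have e0 : 0 < e by rewrite lt_min ltr01 divr_gt0 // mulr_gt0.
have e1 : e <= 1 by rewrite ge_min lexx.
have [_ [q _ <-] qe] := dense _ exp_half_H2 e e0.
have [P1 P1q] := antiderivative_exists q.
have [P PP1] := antiderivative_exists P1.
have [Q QP] := square_difference_horner P.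
have near z : 0 <= Im z -> cmod (square_factor * exp_half z - Q.[z]) <=
    e * expR (2^-1 * (Im z + 1 + (cmod z + 2) `^ p)).
  by move=> z0; rewrite QP; exact: (square_difference_H2 q P P1).
have Qreal (x : R) : cmod Q.[x%:C%C] <= B * expR (2^-1 * (`|x| + 2) `^ p).
  have xn : cmod (x%:C%C) = `|x| by rewrite cmodE /= expr0n addr0 sqrtr_sqr.
  have := near x%:C%C (lexx 0); rewrite xn -[Im _]/(0 : R) add0r => nx.
  have -> : Q.[x%:C%C] = square_factor * exp_half x%:C%C +
      - (square_factor * exp_half x%:C%C - Q.[x%:C%C]) by ring.
  apply: le_trans (cmodD _ _) _.
  rewrite cmodN cmodM cmod_exp_half -[Im _]/(0 : R) mul0r expR0 mulr1 mulrDl.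
  apply: lerD.
    by rewrite ler_peMr ?(ltW k0) // -expR0 ler_expR mulr_ge0 ?powR_ge0.
  apply: le_trans nx _.
  rewrite -expRD -{2}[2^-1]mulr1 -mulrDr; move: (expR_ge0 (2^-1 * (1 + (`|x| + 2) `^ p))).
  by move=> h0; rewrite ler_piMl.
have Qy := MP B Q B0 Qreal y y0.
have := near (Complex 0 y) y0.
have -> : cmod (Complex 0 y) = y by rewrite cmodE /= expr0n add0r sqrtr_sqr ger0_norm.
rewrite -[Im _]/y -/S => ny.
have : k * expR (2^-1 * y) <= cmod Q.[Complex 0 y] + e * S.
  have -> : k * expR (2^-1 * y) = cmod (square_factor * exp_half (Complex 0 y)).
    by rewrite cmodM cmod_exp_half -[Im _]/y [2^-1 * y]mulrC.
  rewrite -[square_factor * _](subrK Q.[Complex 0 y]) addrC.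
  by apply: le_trans (cmodD _ _) _; rewrite lerD2l.
have eS : e * S <= gap / 2.
  rewrite -ler_pdivlMr // ge_min; apply/orP; right.
  by rewrite invfM mulrA.
have kA : k * A = B * expR (3 / 2) by rewrite /A mulrC divfK // gt_eqF.
have gE : gap = k * expR (2^-1 * y) -
    B * expR (3 / 2) * ((1 + y) ^+ M * expR (8^-1 * y)).
  by rewrite -kA /gap; ring.
lra.
Qed.

End NotDense.

Theorem theorem1p6 (R : realType) (p : R) (hp0 : 0 < p) (hp1 : p < 1) :
  @polynomials R `<=` H2 (weight p) /\
  ~ H2_dense (weight p) (@polynomials R).
Proof.
split; last exact: polynomials_not_dense.
by move=> _ [q _ <-]; exact: horner_H2.
Qed.
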